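(* 1. Let $p\in[1,+\infty)$ and let $\nu,\mu$ be translation-invariant probability measures on $\Omega$. Then the limit $$D_p(\nu,\mu):=\lim_{n\to\infty}\frac{D_{p,\Lambda_n}(\nu,\mu)}{|\Lambda_n|^{1/p}}$$ exists, and $D_p$ defines a (finite) metric on the set $\mathcal{M}^1_\tau(\Omega)$ of translation-invariant probability measures on $\Omega$. 2. Let $\nu,\mu\in\mathcal{M}^1(\Omega)$ be probability measures on $\Omega$. Then $$D_\infty(\nu,\mu):=\lim_{n\to\infty}D_{\infty,\Lambda_n}(\nu,\mu)=\sup_{n\in\mathbb{N}}D_{\infty,\Lambda_n}(\nu,\mu)$$ exists, and $D_\infty$ defines a (finite) metric on $\mathcal{M}^1(\Omega)$.
   Context: $S$ is a finite set, $d\ge1$, $\Omega=S^{\mathbb{Z}^d}$ with the product of discrete topologies and Borel $\sigma$-algebra; $\Lambda_n=[-n,n]^d\cap\mathbb{Z}^d$. A probability measure on $\Omega$ is translation invariant if it is invariant under all shifts $(\tau_i\eta)_j=\eta_{j-i}$, $i\in\mathbb{Z}^d$. For finite nonempty $\Lambda\subset\mathbb{Z}^d$, $\mathrm{Loc}(\Omega_\Lambda)$ is the set of functions $f:\Omega\to\mathbb{R}$ depending only on the coordinates in $\Lambda$. Oscillations: $\delta_i f=\sup\{f(\sigma)-f(\tilde\sigma):\sigma_j=\tilde\sigma_j\ \forall j\neq i\}$; $\|\delta f\|_q=(\sum_{i}(\delta_i f)^q)^{1/q}$ for $q<\infty$ and $\|\delta f\|_\infty=\sup_i\delta_i f$.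 With $q$ the conjugate exponent of $p\in[1,\infty]$ ($1/p+1/q=1$), $$D_{p,\Lambda}(\nu,\mu)=\sup_{f\in\mathrm{Loc}(\Omega_\Lambda),\ f\text{ non-constant}}\frac{\int f\,d\nu-\int f\,d\mu}{\|\delta f\|_q}=\sup_{f\in\mathrm{Loc}(\Omega_\Lambda),\ \|\delta f\|_q\le1}\Big(\int f\,d\nu-\int f\,d\mu\Big).$$ *)

(* Defs.v *)
From HB Require Import structures.
From mathcomp Require Import all_boot all_order all_algebra finmap.
From mathcomp Require Import all_classical all_reals all_analysis.

Set Implicit Arguments.
Unset Strict Implicit.
Unset Printing Implicit Defensive.
Import Order.TTheory GRing.Theory Num.Theory.
Import numFieldNormedType.Exports.

Local Open Scope classical_set_scope.
Local Open Scope ring_scope.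

(* Measurable types are pointed in the library, so the alphabet is a nonempty
   finite set. Over an empty alphabet there are no configurations, hence no
   probability measures. *)
#[short(type="finPointedType")]
HB.structure Definition FinPointed := {S of Finite S & Pointed S}.

Notation site d := 'rV[int]_d.

Definition config (d : nat) (S : finPointedType) :=
  prod_topology (fun _ : site d => discrete_topology S).

Section configurations.
Variables (d : nat) (S : finPointedType).

HB.instance Definition _ := Topological.on (config d S).
HB.instance Definition _ := isPointed.Build (config d S) (fun=> point).
(* The measurable sets of [config d S] are the Borel sets. *)
HB.instance Definition _ :=
  Measurable.copy (config d S) (g_sigma_algebraType (@open (config d S))).

Definition shift (i : site d) (eta : config d S) : config d S :=
  fun j => eta (j - i).

End configurations.

Section box.
Variable d : nat.

Definition box (n : nat) : {fset site d} :=
  fset_set [set i : site d | forall k, `|i ord0 k| <= n%:Z].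

(* [fset_set] is [fset0] on infinite sets; this shows that [box] is not that
   degenerate case. *)
Lemma in_box n (i : site d) : i \in box n = [forall k, `|i ord0 k| <= n%:Z].
Proof.
rewrite in_fset_set; last first.
  apply: (sub_finite_set (B := range (fun x : {ffun 'I_d -> 'I_(n + n).+1} =>
    \row_k ((x k : nat)%:Z - n%:Z) : site d))); last first.
    exact/finite_image/finite_finset.
  move=> j /= jn; exists [ffun k => inord `|j ord0 k + n%:Z|] => //.
  apply/rowP => k; rewrite mxE ffunE inordK.
    rewrite gez0_abs ?addrK// -lerBlDr sub0r.
    by have := jn k; rewrite ler_norml => /andP[].
  have /andP[jl jr] : - n%:Z <= j ord0 k <= n%:Z by rewrite -ler_norml.
  rewrite ltnS -lez_nat gez0_abs; last by rewrite -lerBlDr sub0r.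
  by rewrite PoszD lerD2r.
by apply/idP/forallP => [/set_mem//|?]; exact/mem_set.
Qed.

End box.

Section distances.
Variables (R : realType) (d : nat) (S : finPointedType).
Implicit Types (f : config d S -> R) (nu mu : probability (config d S) R).
Local Open Scope ereal_scope.

Definition translation_invariant nu : Prop :=
  forall (i : site d) (A : set (config d S)), measurable A ->
    nu (shift i @^-1` A) = nu A.

Definition local_on (L : {fset site d}) f : Prop :=
  forall s t : config d S, (forall j, j \in L -> s j = t j) -> f s = f t.

Definition osc f (i : site d) : \bar R :=
  ereal_sup [set x | exists s t : config d S,
    (forall j, j != i -> s j = t j) /\ x = (f s - f t)%:E].

Definition osc_norm (q : \bar R) f : \bar R :=
  match q with
  | q'%:E => (\esum_(i in [set: site d]) (osc f i `^ q')) `^ (q'^-1)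
  | +oo => ereal_sup (range (osc f))
  | -oo => 0 (* junk value: a conjugate exponent is never -oo *)
  end.

(* The supremum over the unit ball of the seminorm, rather than that of the
   quotients over nonconstant [f], because the latter is over the empty set
   when the alphabet is a singleton. *)
Definition dist_on (p : \bar R) (L : {fset site d}) nu mu : \bar R :=
  ereal_sup [set \int[nu]_s (f s)%:E - \int[mu]_s (f s)%:E |
    f in [set f | local_on L f /\ osc_norm (hoelder_conjugate p) f <= 1]].

Definition scaled_dist (p : R) nu mu (n : nat) : \bar R :=
  dist_on p%:E (box d n) nu mu / (#|` box d n|%:R `^ p^-1)%:E.

Definition Dp (p : R) nu mu : \bar R := limn (scaled_dist p nu mu).

Definition Dinfty nu mu : \bar R := limn (fun n => dist_on +oo (box d n) nu mu).

(* Measures are functions on all subsets in the library, with unspecified values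
   on nonmeasurable ones, so two of them are identified when they agree on
   Borel sets. *)
Definition finite_metric_on (M : set (probability (config d S) R))
    (D : probability (config d S) R -> probability (config d S) R -> \bar R) :
    Prop :=
  [/\ forall nu mu, M nu -> M mu -> D nu mu \is a fin_num,
      forall nu mu, M nu -> M mu -> 0 <= D nu mu,
      forall nu mu, M nu -> M mu ->
        (D nu mu = 0 <-> forall A, measurable A -> nu A = mu A),
      forall nu mu, M nu -> M mu -> D nu mu = D mu nu &
      forall nu mu la, M nu -> M mu -> M la ->
        D nu la <= D nu mu + D mu la].

End distances.

(* Main.v *)
Require Import Defs.
From mathcomp Require Import all_boot all_order all_algebra finmap.
From mathcomp Require Import all_classical all_reals all_analysis.
From mathcomp Require Import ring lra zify.
Import Order.TTheory GRing.Theory Num.Theory.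
Import numFieldNormedType.Exports.
Local Open Scope classical_set_scope.
Local Open Scope ring_scope.

(** Let [q] be the conjugate exponent of [p]. If [f] is supported on the box [m]
   and has [osc_norm q f <= 1], put [K] translates of [f] on disjoint copies of
   that box inside the box [n]: their sum times [K `^ - q^-1] still has norm at
   most 1, and for invariant measures its integrals differ by [K `^ p^-1] times
   the difference of those of [f]. Since the copies cover all but a boundary
   layer of the box [n], the scaled distances are almost nondecreasing in [n];
   being bounded by 1 (Hoelder), they converge to their supremum. A supremum of
   box distances inherits symmetry and the triangle inequality, and it separates
   measures because an open set is an increasing union of sets each depending on
   the sites of one box. *)

(** * Local sets and functions, exhaustion by boxes, translations *)

Section local_functions.
Context {R : realType} {d : nat} {S : finPointedType}.
Implicit Types (L : {fset site d}) (s t : config d S) (f g : config d S -> R).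
Implicit Types (U : set (config d S)).

Definition agree L s t := forall j, j \in L -> s j = t j.

Definition local_set L U := forall s t, agree L s t -> U s -> U t.

(** A finite intersection of preimages of singletons, open in the discrete alphabet, under
    coordinate projections. *)
Lemma agree_nbhs L s : nbhs s (agree L s).
Proof.
have -> : agree L s = [set t | forall j, j \in enum_fset L -> s j = t j].
  by [].
elim: (enum_fset L) => [|i l IH].
  by apply: (@filterS _ _ (nbhs_filter s) _ _ _ (@filterT _ _ (nbhs_filter s))).
have nb : nbhs s [set t | s i = t i].
  have si : nbhs (proj i s : discrete_topology S) [set s i].
    exact: discrete_set1.
  have := @proj_continuous _ (fun=> discrete_topology S) i s _ si.
  rewrite nbhs_simpl /=.
  by apply: (@filterS _ _ (nbhs_filter s)) => t /esym.
have := @filterI _ _ (nbhs_filter s) _ _ nb IH.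
apply: (@filterS _ _ (nbhs_filter s)) => t [/= sti stl] j.
by rewrite inE => /predU1P[->//|]; exact: stl.
Qed.

Lemma local_set_open L U : local_set L U -> open U.
Proof.
move=> loc; rewrite openE => s Us; rewrite /interior /=.
have := agree_nbhs L s; apply: (@filterS _ _ (nbhs_filter s)) => t st.
exact: (loc s).
Qed.

Lemma local_set_measurable L U : local_set L U -> measurable U.
Proof. by move=> /local_set_open oU; exact: sub_sigma_algebra. Qed.

Lemma box_exhaust (i : site d) : exists n, i \in box d n.
Proof.
exists (\max_k `|i ord0 k|)%N; rewrite in_box; apply/forallP => k.
by rewrite -abszE lez_nat; exact: leq_bigmax.
Qed.

Lemma box_mono m n : (m <= n)%N -> forall i, i \in box d m -> i \in box d n.
Proof.
move=> mn i; rewrite !in_box => /forallP im; apply/forallP => k.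
by apply: le_trans (im k) _; rewrite lez_nat.
Qed.

(** The sets [agree (box d n) s] are the base of a filter converging to [s], because every site lies
    in some box. *)
Lemma open_box_local U s : open U -> U s ->
  exists n, agree (box d n) s `<=` U.
Proof.
move=> oU Us.
pose F : set_system (config d S) :=
  filter_from [set: nat] (fun n => agree (box d n) s).
have FF : Filter F.
  apply: filter_from_filter; first by exists 0%N.
  move=> m n _ _; exists (maxn m n) => // t st.
  by split=> j jb; apply: st; apply: box_mono jb; rewrite ?leq_maxl ?leq_maxr.
suff /(_ U) [] : F --> s.
- by apply: open_nbhs_nbhs; split.
- by move=> n _ nU; exists n.
(* The product topology is the supremum of those induced by the coordinates, so convergence is
   tested one site at a time. *)
apply/cvg_sup => i A [_ [[B oB <-] Bs BA]].
have [n bi] := box_exhaust i.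
by exists n => // t st; apply: BA => /=; rewrite -(st i bi).
Qed.

(** Open sets are a generating family stable under intersection, so agreement on them suffices;
    continuity from below reduces an open set to local sets. *)
Lemma measure_ext_box (nu mu : probability (config d S) R) :
  (forall n U, local_set (box d n) U -> nu U = mu U) ->
  forall A, measurable A -> nu A = mu A.
Proof.
move=> eqU; apply: (measure_unique (@open (config d S)) (fun=> setT)) => //.
- exact: openI.
- by move=> _; exact: openT.
- by rewrite bigcup_const//; exists 0%N.
- (* [V n] is the largest subset of [U] depending on the sites of [box d n]. *)
  move=> U oU; pose V n := [set s | agree (box d n) s `<=` U].
  have lV n : local_set (box d n) (V n).
    by move=> s t st sU u tu; apply: sU => j jb; rewrite (st j jb) (tu j jb).
  have UV : \bigcup_n V n = U.
    apply/seteqP; split=> [s [n _]|s Us]; first exact.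
    by have [n ?] := open_box_local U s oU Us; exists n.
  have mV n : measurable (V n) by exact: local_set_measurable (lV n).
  have mU : measurable (\bigcup_n V n) by exact: bigcup_measurable.
  have ndV : nondecreasing_seq V.
    move=> m n mn; apply/subsetPset => s sV t st; apply: sV => j jb.
    exact/st/(box_mono _ _ mn).
  rewrite -UV -(cvg_lim _ (nondecreasing_cvg_mu mV mU ndV))//.
  rewrite -(cvg_lim _ (nondecreasing_cvg_mu mV mU ndV))//.
  by apply/congr_lim/funext => n /=; exact: eqU (lV n).
- by move=> _; rewrite -ge0_fin_numE// fin_num_measure.
Qed.

Lemma local_on_measurable L f : local_on L f -> measurable_fun setT f.
Proof.
move=> lf _ B _; rewrite setTI; apply: (local_set_measurable L) => s t st /=.
by rewrite (lf s t st).
Qed.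

(** All values of [f] are taken on the finitely many patterns on [L], extended by [point]; the sum
    of their absolute values serves as bound. *)
Lemma local_on_bounded L f : local_on L f -> exists M, forall s, `|f s| <= M.
Proof.
move=> lf; pose ext (x : {ffun L -> S}) : config d S :=
  fun j => if insub j is Some u then x u else point.
exists (\sum_x `|f (ext x)|) => s.
have -> : f s = f (ext [ffun u : L => s (val u)]).
  apply: lf => j jL; rewrite /ext insubT/= ffunE//.
by rewrite (bigD1 [ffun u : L => s (val u)])//= lerDl sumr_ge0.
Qed.

Lemma local_on_integrable (nu : probability (config d S) R) L f :
  local_on L f -> nu.-integrable setT (EFin \o f).
Proof.
move=> lf; apply: measurable_bounded_integrable => //.
- by rewrite -ge0_fin_numE// fin_num_measure.
- exact: local_on_measurable lf.
- have [M fM] := local_on_bounded _ _ lf.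
  exists M; split; first by rewrite num_real.
  by move=> x Mx s _ /=; exact: le_trans (fM s) (ltW Mx).
Qed.

Lemma shift_preimage_open (i : site d) U :
  open U -> open ((Defs.shift i : config d S -> config d S) @^-1` U).
Proof.
move=> oU; rewrite openE => s Us; rewrite /interior /=.
have [n nU] := open_box_local _ _ oU Us.
have := agree_nbhs [fset j - i | j in box d n]%fset s.
apply: (@filterS _ _ (nbhs_filter s)) => t st.
apply: nU => j jb; rewrite /Defs.shift st//.
by apply/imfsetP; exists j.
Qed.

Lemma shift_measurable (i : site d) :
  measurable_fun setT (Defs.shift i : config d S -> config d S).
Proof.
apply: (@measurability _ _ _ _ setT _ (@open (config d S))) => //.
move=> _ [U oU <-]; rewrite setTI; apply: sub_sigma_algebra.
exact: shift_preimage_open.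
Qed.

Lemma Rintegral_shift (nu : probability (config d S) R) i L f :
  translation_invariant nu -> local_on L f ->
  \int[nu]_s f (Defs.shift i s) = \int[nu]_s f s.
Proof.
move=> inv lf.
have mi := shift_measurable i.
have lfi : local_on [fset j - i | j in L]%fset (f \o Defs.shift i).
  move=> s t st; apply: lf => j jL; rewrite /Defs.shift st//.
  by apply/imfsetP; exists j.
congr fine.
have := @integral_pushforward _ _ _ _ _ _ mi nu setT (EFin \o f).
rewrite preimage_setT => <- //=.
- apply: eq_measure_integral => A mA _; rewrite /pushforward; exact: inv.
- by apply/measurable_realfun.measurable_EFinP; exact: local_on_measurable lf.
- exact: local_on_integrable lfi.
Qed.

End local_functions.

(** * Oscillations and their norms *)

Section oscillation.
Context {R : realType} {d : nat} {S : finPointedType}.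
Implicit Types (L : {fset site d}) (s t : config d S) (f g : config d S -> R).
Implicit Types (i j : site d) (p q : R).
Local Open Scope ereal_scope.

Lemma osc_ge0 f i : 0 <= osc f i.
Proof.
by apply: ereal_sup_ubound; exists point, point; split=> //; rewrite subrr.
Qed.

Lemma le_osc f i s t :
  (forall j, j != i -> s j = t j) -> (f s - f t)%:E <= osc f i.
Proof. by move=> st; apply: ereal_sup_ubound; exists s, t. Qed.

Lemma osc_le f i (x : \bar R) :
  (forall s t, (forall j, j != i -> s j = t j) -> (f s - f t)%:E <= x) ->
  osc f i <= x.
Proof. by move=> fx; apply: ge_ereal_sup => _ [s [t [st ->]]]; exact: fx. Qed.

Lemma osc_notin L f i : local_on L f -> i \notin L -> osc f i = 0.
Proof.
move=> lf iL; apply/eqP; rewrite eq_le osc_ge0 andbT.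
apply: osc_le => s t st; rewrite (lf s t) ?subrr// => j jL.
by apply: st; apply: contraNneq iL => <-.
Qed.

Lemma osc_fin_num L f i : local_on L f -> osc f i \is a fin_num.
Proof.
move=> lf; have [M fM] := local_on_bounded _ _ lf.
rewrite ge0_fin_numE ?osc_ge0//; apply: le_lt_trans (ltry (M + M)%R).
apply: osc_le => s t _; rewrite lee_fin lerD//.
  exact: le_trans (ler_norm _) (fM s).
by rewrite (le_trans (ler_norm _))// normrN.
Qed.

Lemma oscN f i : osc (fun s => - f s)%R i = osc f i.
Proof.
congr ereal_sup; apply/seteqP; split=> _ [s [t [st ->]]];
  by exists t, s; split=> [j /st//|]; congr EFin; rewrite ?opprK addrC ?opprK.
Qed.

Lemma osc_shift f i j :
  osc (f \o Defs.shift j) i = osc f (i + j).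
Proof.
have shiftN (k : site d) s : Defs.shift k (Defs.shift (- k) s) = s.
  by apply/funext => l; rewrite /Defs.shift opprK subrK.
apply/eqP; rewrite eq_le; apply/andP; split; apply: osc_le => s t st.
  apply: le_osc => k ki; rewrite /Defs.shift st//.
  by apply: contraNneq ki => <-; rewrite subrK.
rewrite -(shiftN j s) -(shiftN j t).
apply: (@le_osc (f \o Defs.shift j) i) => k ki.
by rewrite /Defs.shift st// opprK (inj_eq (addIr _)).
Qed.

(** Telescoping: [s] is turned into [t] one site of [L] at a time, each change costing at most the
    oscillation there. *)
Lemma local_on_osc L f s t :
  local_on L f -> (f s - f t <= \sum_(i <- L) fine (osc f i))%R.
Proof.
move=> lf; pose u j := if j \in L then s j else t j.
have -> : f s = f u by apply: lf => j jL; rewrite /u jL.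
have : forall j, j \notin enum_fset L -> u j = t j.
  by move=> j jL; rewrite /u [in LHS]ifN.
(* The induction is over all [u] that agree with [t] outside the remaining list of sites. *)
elim: (enum_fset L) u => [|i l IH] u ut.
  rewrite big_nil (_ : u = t) ?subrr//; apply/funext => j; exact: ut.
pose v j := if j == i then t j else u j.
rewrite big_cons (_ : f u - f t = f u - f v + (f v - f t))%R; last first.
  by rewrite addrA subrK.
rewrite lerD//.
  rewrite -lee_fin fineK ?(osc_fin_num L)//; apply: le_osc => j ji.
  by rewrite /v ifN.
apply: IH => j jl; rewrite /v; case: ifPn => // ji.
by apply: ut; rewrite inE negb_or ji.
Qed.

(** Oscillations vanish off [L]. A general [h] covers powers with and without a constant factor. *)
Lemma esum_osc L f (h : \bar R -> \bar R) : local_on L f ->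
  h 0 = 0 -> (forall x, 0 <= h x) ->
  \esum_(i in [set: site d]) h (osc f i) = \sum_(i <- L) h (osc f i).
Proof.
move=> lf h0 hge0.
have -> : \esum_(i in [set: site d]) h (osc f i) =
          \esum_(i in [set` L]) h (osc f i).
  rewrite [RHS]esum_mkcond; apply: eq_esum => i _.
  case: ifPn => //; rewrite notin_setE => /negP iL.
  by rewrite (osc_notin _ _ _ lf iL).
by rewrite esum_fset// fsbig_finite//= set_fsetK.
Qed.

Lemma esum_osc_powR L f q : local_on L f -> (0 < q)%R ->
  \esum_(i in [set: site d]) (osc f i `^ q) =
  (\sum_(i <- L) fine (osc f i) `^ q)%:E.
Proof.
move=> lf q0; rewrite (esum_osc L f (fun x => x `^ q))// ?poweR0r ?gt_eqF//.
  rewrite -sumEFin; apply: eq_bigr => i _.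
  by rewrite -[in LHS](fineK (osc_fin_num L f i lf)) poweR_EFin.
by move=> x; exact: poweR_ge0.
Qed.

Lemma osc_norm_le1 f q : (0 < q)%R ->
  (osc_norm q%:E f <= 1) <-> (\esum_(i in [set: site d]) (osc f i `^ q) <= 1).
Proof.
move=> q0; rewrite /osc_norm; set x := esum _ _.
have x0 : 0 <= x by apply: esum_ge0 => i _; exact: poweR_ge0.
have cc (y : \bar R) : 0 <= y -> y \in `[0, +oo].
  by move=> y0; rewrite in_itv/= y0 leey.
have mono r (y z : \bar R) : (0 <= r)%R -> 0 <= y -> y <= z -> y `^ r <= z `^ r.
  move=> r0 y0 yz; apply: gt0_ler_poweR => //; apply: cc => //.
  exact: le_trans yz.
have one r : (1 : \bar R) `^ r = 1 by rewrite poweR_EFin powR1.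
split=> x1.
  have -> : x = (x `^ q^-1) `^ q by rewrite -poweRrM mulVf ?lt0r_neq0// poweRe1.
  rewrite -[leRHS](one q).
  by apply: mono => //; [exact: ltW|exact: poweR_ge0].
by rewrite -[leRHS](one q^-1%R); apply: mono => //; rewrite invr_ge0 ltW.
Qed.

Lemma osc_normy_le1 f :
  (osc_norm +oo f <= 1) <-> (forall i, osc f i <= 1).
Proof.
split=> [f1 i|f1].
  by apply: le_trans f1; apply: ereal_sup_ubound; exists i.
by apply: ge_ereal_sup => _ [i _ <-].
Qed.

End oscillation.

Lemma sumr_fset_const (R : pzRingType) (T : choiceType) (A : {fset T}) (x : R) :
  \sum_(i <- A) x = #|` A|%:R * x.
Proof. by rewrite big_const_seq count_predT iter_addr_0 mulr_natl. Qed.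

(** Meant for the oscillations, at one site, of translates with disjoint supports: powers then
    commute with the sum. *)
Lemma sum_sparse (R V : nmodType) (X : finType) (a : X -> R) (h : R -> V) :
  h 0 = 0 -> (forall x y, a x != 0 -> a y != 0 -> x = y) ->
  h (\sum_x a x) = \sum_x h (a x).
Proof.
move=> h0 a1; have [x0 ax0|a0] := pickP (fun x => a x != 0); last first.
  rewrite !big1// => x _; have /negbFE/eqP -> := a0 x => //.
have ax x : x != x0 -> a x = 0.
  by apply: contraNeq => ax; apply/eqP; exact: a1.
rewrite (bigD1 x0)//= [in RHS](bigD1 x0)//= !big1 ?addr0// => x /ax -> //.
Qed.

(** * The unit ball of the oscillation norm *)

Section unit_ball.
Context {R : realType} {d : nat} {S : finPointedType}.
Implicit Types (L : {fset site d}) (s t : config d S) (f g : config d S -> R).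
Implicit Types (i j : site d).

Lemma hoelder_conjugate_gt1 (p : R) : 1 < p -> exists q : R,
  [/\ 1 < q, p^-1 + q^-1 = 1 & hoelder_conjugate p%:E = q%:E].
Proof.
move=> p1; have p0 : 0 < p by exact: lt_trans p1.
have p10 : 0 < p - 1 by rewrite subr_gt0.
exists (p / (p - 1)); split.
- by rewrite ltr_pdivlMr// mul1r gtrBl.
- by rewrite invf_div -[X in X + _]div1r -mulrDl addrC subrK divff// gt_eqF.
- by rewrite /hoelder_conjugate/= eqe gt_eqF//= inver gt_eqF// -EFinM.
Qed.

Lemma osc_norm_small (q : \bar R) L f : (1 <= q)%E -> local_on L f ->
  (0 < #|` L|)%N -> (forall s t, f s - f t <= #|` L|%:R^-1) ->
  (osc_norm q f <= 1)%E.
Proof.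
move=> q1 lf L0 fL; set c := #|` L|%:R^-1 : R in fL.
have c0 : 0 < c by rewrite invr_gt0 ltr0n.
have c1 : c <= 1 by rewrite invf_le1 ?ltr0n// ler1n.
have oc i : (osc f i <= c%:E)%E by apply: osc_le => s t _; rewrite lee_fin.
case: q q1 => [q||//]; last first.
  by move=> _; apply/osc_normy_le1 => i; exact: le_trans (oc i) _.
rewrite lee_fin => q1; apply/osc_norm_le1; first exact: lt_le_trans q1.
rewrite (esum_osc_powR L)//; last exact: lt_le_trans q1.
rewrite lee_fin.
have -> : 1 = \sum_(i <- L) c.
  by rewrite sumr_fset_const mulfV// pnatr_eq0 -lt0n.
apply: ler_sum => i _; apply: (@le_trans _ _ (c `^ q)).
  apply: ge0_ler_powR; rewrite ?nnegrE ?(ltW c0)//.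
  - exact: le_trans q1.
  - by rewrite fine_ge0 ?osc_ge0.
  - by rewrite -lee_fin fineK// (osc_fin_num L).
by apply: ge1r_powR => //; rewrite c0.
Qed.

(* Hoelder's inequality, through Young's inequality with second factor
   [N `^ - p^-1], where [N] is the cardinal of [L]. *)
Lemma sum_osc_le (p : R) L f : 1 <= p -> local_on L f ->
  (osc_norm (hoelder_conjugate p%:E) f <= 1)%E ->
  \sum_(i <- L) fine (osc f i) <= #|` L|%:R `^ p^-1.
Proof.
rewrite le_eqVlt => /predU1P[<-|p1] lf.
  rewrite hoelder_conjugate1 => /osc_normy_le1 f1; rewrite invr1 powRr1//.
  rewrite -[leRHS]mulr1 -sumr_fset_const; apply: ler_sum => i _.
  by rewrite -lee_fin fineK// (osc_fin_num L).
have [q [q1 pq ->]] := hoelder_conjugate_gt1 _ p1.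
have p0 : 0 < p by exact: lt_trans p1.
have q0 : 0 < q by exact: lt_trans q1.
move=> /(osc_norm_le1 _ _ q0); rewrite (esum_osc_powR L)// lee_fin => f1.
have [L0|L0] := posnP #|` L|.
  by rewrite (cardfs0_eq L0) big_seq_fset0 powR_ge0.
have N0 : 0 < #|` L|%:R :> R by rewrite ltr0n.
rewrite -[leRHS]mul1r -ler_pdivrMr ?powR_gt0// -powRN mulr_suml.
apply: (@le_trans _ _
  (\sum_(i <- L) (fine (osc f i) `^ q / q + #|` L|%:R^-1 / p))).
  apply: ler_sum => i _.
  apply: le_trans.
    apply: (@conjugate_powR R (fine (osc f i)) (#|` L|%:R `^ - p^-1) q p) => //.
    - by rewrite fine_ge0 ?osc_ge0.
    - by rewrite addrC.
  by rewrite -powRrM mulNr mulVf ?gt_eqF// powR_inv1 ?(ltW N0).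
rewrite big_split/= -mulr_suml sumr_fset_const mulrA mulfV ?gt_eqF// mul1r.
by rewrite -pq addrC lerD2l ler_piMl// invr_ge0 ltW.
Qed.

Lemma osc_norm_le_diff (p : R) L f s t : 1 <= p -> local_on L f ->
  (osc_norm (hoelder_conjugate p%:E) f <= 1)%E ->
  f s - f t <= #|` L|%:R `^ p^-1.
Proof.
move=> p1 lf f1; apply: le_trans (local_on_osc _ _ s t lf) _.
exact: sum_osc_le.
Qed.

Lemma osc_normy_le_diff L f s t : local_on L f ->
  (osc_norm (hoelder_conjugate +oo) f <= 1)%E -> f s - f t <= 1.
Proof.
rewrite hoelder_conjugatey => lf /(osc_norm_le1 _ _ ltr01).
rewrite (esum_osc_powR L)// lee_fin; apply: le_trans.
apply: le_trans (local_on_osc _ _ s t lf) _.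
by apply: ler_sum => i _; rewrite powRr1// fine_ge0 ?osc_ge0.
Qed.

(** * Normalized sums of disjoint translates *)

Section packing.
Variables (X : finType) (c : X -> site d) (L : {fset site d}).
Variable f : config d S -> R.
Hypothesis lf : local_on L f.
Hypothesis disj : forall x y i, i + c x \in L -> i + c y \in L -> x = y.

(* The factor is [#|X| `^ - q^-1], for [q] the conjugate exponent of [p]. *)
Definition packed (p : R) s : R :=
  #|X|%:R `^ (p^-1 - 1) * \sum_x f (Defs.shift (c x) s).

Lemma packed_local (p : R) (L' : {fset site d}) :
  (forall x i, i \in L -> i - c x \in L') -> local_on L' (packed p).
Proof.
move=> LL' s t st; congr (_ * _); apply: eq_bigr => x _.
by apply: lf => j /(LL' x); exact: st.
Qed.

Lemma osc_packed (p : R) i : (osc (packed p) i <=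
  (#|X|%:R `^ (p^-1 - 1) * \sum_x fine (osc f (i + c x)))%:E)%E.
Proof.
apply: osc_le => s t st; rewrite lee_fin /packed -mulrBr.
rewrite ler_wpM2l ?powR_ge0// -sumrB; apply: ler_sum => x _.
rewrite -lee_fin fineK ?(osc_fin_num L)// -osc_shift.
exact: (le_osc (f \o Defs.shift (c x)) i s t st).
Qed.

(** At each site at most one translate oscillates. For [p = 1] the factor is 1 and the largest
    oscillation does not grow; for [p > 1] the [q]-th powers add up over [#|X|] translates, which
    the [q]-th power of the factor compensates. *)
Lemma packed_norm (p : R) : (0 < #|X|)%N -> 1 <= p ->
  (osc_norm (hoelder_conjugate p%:E) f <= 1)%E ->
  (osc_norm (hoelder_conjugate p%:E) (packed p) <= 1)%E.
Proof.
move=> X0; have K0 : 0 < #|X|%:R :> R by rewrite ltr0n.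
have sparse i x y : fine (osc f (i + c x)) != 0 ->
    fine (osc f (i + c y)) != 0 -> x = y.
  move=> fx fy; apply: (disj x y i); [move: fx|move: fy]; apply: contraNT => iL.
    by rewrite (osc_notin L).
  by rewrite (osc_notin L).
rewrite le_eqVlt => /predU1P[<-|p1].
  rewrite hoelder_conjugate1 => /osc_normy_le1 f1; apply/osc_normy_le1 => i.
  apply: le_trans (osc_packed _ _) _.
  rewrite invr1 subrr powRr0 mul1r lee_fin.
  (* [h u = 0] encodes [u <= 1]. *)
  pose h (u : R) := (1 < u)%R%:R : R.
  (* By sparsity, [h] of the sum is the sum of the values of [h], all 0 since each oscillation is at
     most 1. *)
  have := @sum_sparse R R X _ h _ (sparse i).
  rewrite {1}/h ltr10 => /(_ erefl).
  rewrite (big1 _ _ (fun x => h _)) => [|x _].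
    rewrite /h; case: ltP => // _ /eqP; by rewrite oner_eq0.
  by rewrite /h ltNge -lee_fin fineK ?f1// (osc_fin_num L).
have [q [q1 pq ->]] := hoelder_conjugate_gt1 _ p1.
have p0 : 0 < p by exact: lt_trans p1.
have q0 : 0 < q by exact: lt_trans q1.
move=> /(osc_norm_le1 _ _ q0) f1; apply/(osc_norm_le1 _ _ q0).
apply: (@le_trans _ _ (\esum_(i in [set: site d])
    \sum_x ((#|X|%:R^-1)%:E * (osc f (i + c x) `^ q)))%E).
  apply: le_esum => i _.
  apply: (@le_trans _ _ ((#|X|%:R `^ (p^-1 - 1) *
     \sum_x fine (osc f (i + c x)))%:E `^ q)%E).
    apply: gt0_ler_poweR; rewrite ?(ltW q0) ?in_itv/= ?leey ?andbT ?osc_ge0//.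
      rewrite lee_fin mulr_ge0 ?powR_ge0// sumr_ge0// => x _.
      by rewrite fine_ge0 ?osc_ge0.
    exact: osc_packed.
  rewrite poweR_EFin powRM ?powR_ge0//; last first.
    by rewrite sumr_ge0// => x _; rewrite fine_ge0 ?osc_ge0.
  rewrite (@sum_sparse _ _ _ _ (fun u => u `^ q)) ?powR0 ?gt_eqF//; last first.
    exact: sparse.
  (* The exponent [(p^-1 - 1) * q] is -1, so the factor becomes [#|X|%:R^-1]. *)
  rewrite -powRrM (_ : p^-1 - 1 = - q^-1); last first.
    by rewrite -pq opprD addrA subrr add0r.
  rewrite mulNr mulVf ?gt_eqF// powR_inv1 ?(ltW K0)// mulr_sumr -sumEFin.
  apply: lee_sum => x _.
  by rewrite EFinM -poweR_EFin fineK// (osc_fin_num L).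
rewrite esum_sum//; last first.
  by move=> i x _ _; rewrite mule_ge0 ?poweR_ge0// lee_fin invr_ge0 ltW.
apply: (@le_trans _ _ (\sum_(x : X) (#|X|%:R^-1)%:E)%E); last first.
  by rewrite sumEFin lee_fin sumr_const -[leLHS]mulr_natl mulfV ?gt_eqF.
apply: lee_sum => x _.
(* The sum over all sites is invariant under [i |-> i + c x], so every translate contributes the
   same amount. *)
rewrite -(@reindex_esum R _ _ setT setT (fun i => i + c x)
  (fun i => (#|X|%:R^-1)%:E * osc f i `^ q)%E); last first.
  by split=> // [i j _ _ /addIr//|i _]; exists (i - c x) => //=; rewrite subrK.
rewrite (esum_osc L f (fun u => (#|X|%:R^-1)%:E * u `^ q)%E)//; last 2 first.
- by rewrite poweR0r ?gt_eqF// mule0.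
- by move=> u; rewrite mule_ge0 ?poweR_ge0// lee_fin invr_ge0 ltW.
rewrite -ge0_sume_distrr; last by move=> i _; exact: poweR_ge0.
rewrite -[leRHS]mule1 lee_pmul2l// ?lte_fin ?invr_gt0//.
rewrite -(esum_osc L f (fun u => u `^ q)%E)// ?poweR0r ?gt_eqF// => u.
exact: poweR_ge0.
Qed.

End packing.
End unit_ball.

(** * Distances on finite sets of sites *)

Section distance.
Context {R : realType} {d : nat} {S : finPointedType}.
Implicit Types (L : {fset site d}) (s t : config d S) (f g : config d S -> R).
Implicit Types (nu mu la : probability (config d S) R).

Lemma local_onN L f : local_on L f -> local_on L (fun s => - f s).
Proof. by move=> lf s t st; rewrite (lf s t st). Qed.

Lemma local_on_cst L (x : R) : local_on L (fun _ : config d S => x).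
Proof. by []. Qed.

Lemma local_on_Rintegral nu L f : local_on L f ->
  (\int[nu]_s (f s)%:E = (\int[nu]_s f s)%:E)%E.
Proof.
move=> lf; rewrite fineK//; apply: integrable_fin_num => //.
exact: local_on_integrable lf.
Qed.

Lemma Rintegral_prob_cst nu (x : R) : \int[nu]_s x = x.
Proof.
by rewrite Rintegral_cst// [X in fine X](probability_setT nu) mulr1.
Qed.

(** Integrate [f s - f t <= x] in [s] against [nu], then in [t] against [mu]. *)
Lemma Rintegral_sub_le nu mu L f (x : R) : local_on L f ->
  (forall s t, f s - f t <= x) ->
  \int[nu]_s f s - \int[mu]_s f s <= x.
Proof.
move=> lf fx; rewrite lerBlDl -lerBlDr.
rewrite -[leLHS](Rintegral_prob_cst mu).
apply: le_Rintegral => //.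
- exact: (@local_on_integrable _ _ _ _ L).
- exact: local_on_integrable lf.
move=> t _; rewrite lerBlDr -[leRHS](Rintegral_prob_cst nu).
apply: le_Rintegral => //.
- exact: local_on_integrable lf.
- exact: (@local_on_integrable _ _ _ _ L).
by move=> s _; rewrite -lerBlDl.
Qed.

Lemma Rintegral_sum_local nu L (X : finType) (g : X -> config d S -> R) :
  (forall x, local_on L (g x)) ->
  \int[nu]_s (\sum_x g x s) = \sum_x \int[nu]_s g x s.
Proof.
move=> lg; elim: (index_enum X) => [|x r IH].
  rewrite big_nil (eq_Rintegral _ (g := fun=> 0)) ?Rintegral_prob_cst// => s _.
  by rewrite big_nil.
rewrite big_cons -IH -RintegralD//.
- by apply: eq_Rintegral => s _; rewrite big_cons.
- exact: local_on_integrable (lg x).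
apply: (@local_on_integrable _ _ _ _ L) => s t st.
by apply: eq_bigr => y _; exact: lg.
Qed.

Section packing_integral.
Variables (X : finType) (c : X -> site d) (L : {fset site d}).
Variable f : config d S -> R.
Hypothesis lf : local_on L f.

Lemma Rintegral_packed nu (p : R) : (0 < #|X|)%N -> translation_invariant nu ->
  \int[nu]_s packed X c f p s = #|X|%:R `^ p^-1 * \int[nu]_s f s.
Proof.
move=> X0 inv; have K0 : 0 < #|X|%:R :> R by rewrite ltr0n.
(* [L'] collects the sites read by any of the translates, so that all are local on one common
   set. *)
pose l := flatten [seq [seq i - c x | i <- L] | x <- enum X].
pose L' := [fset i | i : site d in l]%fset.
have LL' x i : i \in L -> i - c x \in L'.
  move=> iL; rewrite !inE; apply/flattenP; exists [seq i - c x | i <- L].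
    by apply/mapP; exists x => //; rewrite mem_enum.
  by apply/mapP; exists i.
have lx x : local_on L' (fun s => f (Defs.shift (c x) s)).
  by move=> s t st; apply: lf => j /(LL' x); exact: st.
rewrite /packed RintegralZl//; last first.
  apply: (@local_on_integrable _ _ _ _ L') => s t st.
  by apply: eq_bigr => x _; exact: lx.
rewrite (Rintegral_sum_local _ L')//.
under eq_bigr do rewrite (Rintegral_shift _ _ _ _ inv lf).
rewrite sumr_const -[X in _ * X]mulr_natl mulrA; congr (_ * _).
have KN0 := lt0r_neq0 K0.
by rewrite powRB ?powRr1 ?divfK ?(ltW K0)// KN0 implybT.
Qed.

End packing_integral.

Local Open Scope ereal_scope.

Lemma le_dist_on p L nu mu f : local_on L f ->
  osc_norm (hoelder_conjugate p) f <= 1 ->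
  (\int[nu]_s f s - \int[mu]_s f s)%R%:E <= dist_on p L nu mu.
Proof.
move=> lf f1; apply: ereal_sup_ubound; exists f => //.
by rewrite !(local_on_Rintegral _ _ _ lf).
Qed.

Lemma dist_on_le p L nu mu (x : \bar R) :
  (forall f, local_on L f -> osc_norm (hoelder_conjugate p) f <= 1 ->
    (\int[nu]_s f s - \int[mu]_s f s)%R%:E <= x) ->
  dist_on p L nu mu <= x.
Proof.
move=> fx; apply: ge_ereal_sup => _ [f [lf f1] <-].
by rewrite !(local_on_Rintegral _ _ _ lf); exact: fx.
Qed.

Lemma osc_normN q f : osc_norm q (fun s => - f s)%R = osc_norm q f.
Proof.
have E : osc (fun s => - f s)%R = osc f by apply/funext => i; exact: oscN.
by case: q => [q||] //=; rewrite E.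
Qed.

(** The unit ball is stable under [f |-> - f]. *)
Lemma dist_onC p L nu mu : dist_on p L nu mu = dist_on p L mu nu.
Proof.
suff le nu1 nu2 : dist_on p L nu1 nu2 <= dist_on p L nu2 nu1.
  by apply/eqP; rewrite eq_le !le.
apply: dist_on_le => f lf f1.
have := @le_dist_on p L nu2 nu1 _ (local_onN _ _ lf).
rewrite osc_normN => /(_ f1); apply: le_trans; rewrite lee_fin.
have RN nu0 : (\int[nu0]_s - f s = - \int[nu0]_s f s)%R.
  rewrite -[RHS]mulN1r -RintegralZl//; last exact: local_on_integrable lf.
  by apply: eq_Rintegral => s _; rewrite mulN1r.
by rewrite !RN opprK addrC.
Qed.

Lemma dist_on_triangle p L nu mu la :
  dist_on p L nu la <= dist_on p L nu mu + dist_on p L mu la.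
Proof.
apply: dist_on_le => f lf f1.
rewrite -(addrNK (\int[mu]_s f s)%R (\int[nu]_s f s)%R) -addrA EFinD.
by rewrite leeD// le_dist_on.
Qed.

Lemma dist_on_eq p L nu mu :
  (forall A, measurable A -> nu A = mu A) -> dist_on p L nu mu <= 0.
Proof.
move=> E; apply: dist_on_le => f lf f1; rewrite lee_fin.
rewrite (_ : (\int[nu]_s f s = \int[mu]_s f s)%R) ?subrr//.
by congr fine; apply: eq_measure_integral => A mA _; exact: E.
Qed.

Lemma dist_on_subset p L L' nu mu : (forall i, i \in L -> i \in L') ->
  dist_on p L nu mu <= dist_on p L' nu mu.
Proof.
move=> LL'; apply: dist_on_le => f lf f1; apply: le_dist_on => //.
by move=> s t st; apply: lf => j /LL'; exact: st.
Qed.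

(** The zero function is in the unit ball. *)
Lemma dist_on_ge0 p L nu mu : 1 <= p -> (0 < #|` L|)%N ->
  0 <= dist_on p L nu mu.
Proof.
move=> p1 L0.
have := @le_dist_on p L nu mu _ (local_on_cst L 0).
rewrite !Rintegral_prob_cst subrr; apply.
apply: (osc_norm_small _ L) => //; first exact: hoelder_conj_ge1.
by move=> _ _; rewrite subrr invr_ge0.
Qed.

Lemma dist_on_le_card (p : R) L nu mu : (1 <= p)%R ->
  dist_on p%:E L nu mu <= (#|` L|%:R `^ p^-1)%:E.
Proof.
move=> p1; apply: dist_on_le => f lf f1; rewrite lee_fin.
by apply: (Rintegral_sub_le _ _ L) => // s t; exact: osc_norm_le_diff.
Qed.

Lemma dist_ony_le1 L nu mu : dist_on +oo L nu mu <= 1.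
Proof.
apply: dist_on_le => f lf f1; rewrite lee_fin.
by apply: (Rintegral_sub_le _ _ L) => // s t; exact: (osc_normy_le_diff L).
Qed.

(** Each competitor [f] on [L] yields the competitor [packed X c f p] on [L']. *)
Lemma dist_on_packing (p : R) L L' (X : finType) (c : X -> site d) nu mu :
  (1 <= p)%R -> (0 < #|X|)%N ->
  (forall x y i, (i + c x)%R \in L -> (i + c y)%R \in L -> x = y) ->
  (forall x i, i \in L -> (i - c x)%R \in L') ->
  translation_invariant nu -> translation_invariant mu ->
  (#|X|%:R `^ p^-1)%:E * dist_on p%:E L nu mu <= dist_on p%:E L' nu mu.
Proof.
move=> p1 X0 disj LL' inu imu.
have K0 : (0 < #|X|%:R `^ p^-1 :> R)%R by rewrite powR_gt0 ?ltr0n.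
rewrite muleC -lee_pdivlMr//.
apply: dist_on_le => f lf f1; rewrite lee_pdivlMr// -EFinM.
rewrite mulrC mulrBr -!(Rintegral_packed _ c _ _ lf)//.
apply: le_dist_on.
- exact: (packed_local _ _ L).
- exact: (packed_norm _ _ L).
Qed.

(** A local set is tested by its indicator, scaled by the inverse volume of the box so as to lie in
    the unit ball; symmetry turns the inequality of masses into equality. *)
Lemma dist_on_box_separates (p : \bar R) nu mu : 1 <= p ->
  (forall n, dist_on p (box d n) nu mu <= 0) ->
  forall A, measurable A -> nu A = mu A.
Proof.
move=> p1 D0; apply: measure_ext_box => n U lU.
have box0 : (0 < #|` box d n|)%N.
  rewrite cardfs_gt0; apply/fset0Pn; exists 0%R.
  by rewrite in_box; apply/forallP => k; rewrite mxE normr0.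
have mU := local_set_measurable _ _ lU.
pose e : R := (#|` box d n|%:R^-1)%R.
have e0 : (0 < e)%R by rewrite invr_gt0 ltr0n.
have lI : local_on (box d n) (fun s => e * \1_U s)%R.
  move=> s t st; rewrite !indicE; congr (_ * (nat_of_bool _)%:R)%R.
  apply/idP/idP; rewrite !inE; apply: lU => //.
  by move=> j /st.
have I1 : osc_norm (hoelder_conjugate p) (fun s => e * \1_U s)%R <= 1.
  apply: osc_norm_small lI _ _ => //; first exact: hoelder_conj_ge1.
  by move=> s t; rewrite -mulrBr -[leRHS]mulr1 ler_wpM2l ?(ltW e0).
have RI nu0 : (\int[nu0]_s (e * \1_U s) = e * fine (nu0 U))%R.
  rewrite RintegralZl//.
    by congr (_ * _)%R; rewrite /Rintegral integral_indic// setIT.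
  apply: (@local_on_integrable _ _ _ _ (box d n)) => s t st.
  (* Locality of the bare indicator follows by cancelling [e] in [lI]. *)
  have /mulfI := lt0r_neq0 e0; apply; exact: lI.
have le nu1 nu2 : dist_on p (box d n) nu1 nu2 <= 0 ->
    (fine (nu1 U) <= fine (nu2 U))%R.
  move=> /(le_trans (le_dist_on _ _ nu1 nu2 _ lI I1)).
  by rewrite lee_fin !RI -mulrBr pmulr_rle0// subr_le0.
have E : fine (nu U) = fine (mu U).
  by apply/eqP; rewrite eq_le le//= le// dist_onC.
rewrite -(fineK (fin_num_measure nu U mU)) E.
by rewrite fineK// fin_num_measure.
Qed.

End distance.

(** Bernoulli's inequality, to bound from below the fraction of a box covered by tiles. *)
Lemma bernoulli_ineq (R : realDomainType) (x : R) (d : nat) : 0 <= x <= 1 ->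
  1 - d%:R * (1 - x) <= x ^+ d.
Proof.
move=> /andP[x0 x1]; elim: d => [|d IH]; first by rewrite mul0r subr0 expr0.
rewrite exprS; apply: le_trans (ler_wpM2l x0 IH).
rewrite -natr1 -subr_ge0.
have -> : x * (1 - d%:R * (1 - x)) - (1 - (d%:R + 1) * (1 - x)) =
  d%:R * (1 - x) ^+ 2 by ring.
by rewrite mulr_ge0 ?sqr_ge0.
Qed.

(** * Cardinals and tilings of boxes *)

Section boxes.
Variable d : nat.

Lemma card_box n : #|` box d n| = ((2 * n).+1 ^ d)%N.
Proof.
pose g (x : {ffun 'I_d -> 'I_(2 * n).+1}) : site d :=
  \row_k ((x k : nat)%:Z - n%:Z).
have gI : injective g.
  move=> x y /rowP xy; apply/ffunP => k; apply: val_inj => /=.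
  by have := xy k; rewrite !mxE => /addIr [].
have /perm_size : perm_eq (enum_fset (box d n)) [seq g x | x : {ffun _ -> _}].
  apply: uniq_perm; [exact: fset_uniq|by rewrite map_inj_uniq// enum_uniq|].
  move=> i; rewrite [LHS]in_box; apply/forallP/mapP => [ib|[x _ ->] k].
    exists [ffun k => inord `|(i ord0 k + n%:Z)%R|%N].
      by rewrite mem_enum.
    apply/rowP => k; rewrite mxE ffunE.
    rewrite (_ : i 0 k = i ord0 k)//; move: (i ord0 k) (ib k) => z zn.
    by rewrite inordK; lia.
  rewrite mxE; have := ltn_ord (x k); move: (nat_of_ord (x k)) => a an. lia.
by rewrite size_map -cardE card_ffun !card_ord.
Qed.

Lemma card_box_gt0 n : (0 < #|` box d n|)%N.
Proof. by rewrite card_box expn_gt0. Qed.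

Section tiles.
Variables m n : nat.

(** In each coordinate, the quotient is the number of disjoint intervals of [2 * m + 1] integers
    that fit into [2 * n + 1] consecutive ones. *)
Definition tile_index := {ffun 'I_d -> 'I_((2 * n).+1 %/ (2 * m).+1)}.

(* The centre of a translate of [box d m] in [box d n] is [- tile x]. *)
Definition tile (x : tile_index) : site d :=
  \row_k (n%:Z - m%:Z - ((2 * m).+1 * x k)%N%:Z).

Lemma card_tile_index : #|{: tile_index}| = (((2 * n).+1 %/ (2 * m).+1) ^ d)%N.
Proof. by rewrite card_ffun !card_ord. Qed.

Lemma tile_disjoint x y i :
  i + tile x \in box d m -> i + tile y \in box d m -> x = y.
Proof.
rewrite !in_box => /forallP xi /forallP yi; apply/ffunP => k; apply: val_inj.
have := xi k; have := yi k; rewrite !mxE /=.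
move: (i ord0 k) (nat_of_ord (x k)) (nat_of_ord (y k)) => z a b za zb.
(* Distinct indices put centres at least [2 * m + 1] apart, whereas two points of a tile differ by
   at most [2 * m]. *)
have sep (u v : nat) : (u < v)%N ->
    ((2 * m).+1 * u + (2 * m).+1 <= (2 * m).+1 * v)%N.
  by move=> uv; rewrite addnC -mulnS leq_mul2l.
have [/sep|/sep|//] := ltngtP a b; lia.
Qed.

(** Tiles start at [- n], and the last one ends by [n] because
    [(2 * m).+1 * (x k).+1 <= (2 * n).+1]. *)
Lemma tile_subbox x i : i \in box d m -> i - tile x \in box d n.
Proof.
rewrite !in_box => /forallP im; apply/forallP => k; have := im k.
rewrite !mxE; have := leq_trunc_div (2 * n).+1 (2 * m).+1.
have : ((2 * m).+1 * (x k).+1 <= (2 * m).+1 * ((2 * n).+1 %/ (2 * m).+1))%N.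
  by rewrite leq_mul2l ltn_ord orbT.
rewrite mulnS [X in (_ <= X)%N -> _]mulnC.
move: (i ord0 k) (_ %/ _ * _)%N (nat_of_ord (x k)) => z q a; lia.
Qed.

End tiles.
End boxes.

(** * Convergence of almost nondecreasing sequences *)

Section limit.
Context {R : realType}.

(** Fix [m] with [u m] within [e / 2] of the supremum. As [C m] does not depend on [n], the
    correction drops below [e / 2] for large [n], and it costs no more than that since
    [u m <= 1]. *)
Lemma cvg_sup_almost_monotone (u C : nat -> R) : (forall n, 0 <= u n <= 1) ->
  (forall m n, (m <= n)%N -> (1 - C m / n.+1%:R) * u m <= u n) ->
  (forall m, 0 <= C m) ->
  (u n)%:E @[n --> \oo] --> ereal_sup (range (fun n => (u n)%:E)).
Proof.
move=> u01 uC C0.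
have ub : has_ubound (range u) by exists 1 => _ [n _ <-]; case/andP: (u01 n).
have ne : range u !=set0 by exists (u 0%N), 0%N.
have -> : ereal_sup (range (fun n => (u n)%:E)) = (sup (range u))%:E.
  rewrite -ereal_sup_EFin//; congr ereal_sup.
  by rewrite image_comp.
apply: cvg_EFin; first by near=> n.
apply/cvgrPdist_le => /= e e0.
have [_ [m _ <-] um] : exists2 x, range u x & sup (range u) - e / 2 < x.
  by apply: sup_adherent; [rewrite divr_gt0|split].
near=> n.
have mn : (m <= n)%N by near: n; exact: nbhs_infty_ge.
have un : u n <= sup (range u) by apply: ub_le_sup => //; exists n.
rewrite ger0_norm ?subr_ge0//.
have Ce : C m / n.+1%:R <= e / 2.
  rewrite ler_pdivrMr// -ler_pdivrMl ?divr_gt0//.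
  near: n; exists (Num.truncn ((e / 2)^-1 * C m)) => // k /= k1.
  apply: le_trans (ltW (truncnS_gt _)) _.
  by rewrite ler_nat ltnS.
have := uC _ _ mn; have /andP[um0 um1] := u01 m.
have : 0 <= C m / n.+1%:R by rewrite divr_ge0.
move: (C m / n.+1%:R) Ce => c ce c0; have := ler_piMr c0 um1; move: um.
move: (sup _) => l; lra.
Unshelve. all: by end_near. Qed.

End limit.

(** * Limits of box distances and their metric properties *)

Section metric.
Context {R : realType} {d : nat} {S : finPointedType}.
Implicit Types (nu mu la : probability (config d S) R).
Local Open Scope ereal_scope.

Lemma scaled_distE (p : R) nu mu n : (1 <= p)%R ->
  scaled_dist p nu mu n =
  dist_on p%:E (box d n) nu mu * ((#|` box d n|%:R `^ p^-1)^-1)%:E.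
Proof.
move=> p1; rewrite /scaled_dist inver gt_eqF// powR_gt0// ltr0n.
exact: card_box_gt0.
Qed.

Lemma scaled_dist_ge0 (p : R) nu mu n : (1 <= p)%R ->
  0 <= scaled_dist p nu mu n.
Proof.
move=> p1; rewrite scaled_distE// mule_ge0//.
by rewrite dist_on_ge0// card_box_gt0.
Qed.

Lemma scaled_dist_le1 (p : R) nu mu n : (1 <= p)%R ->
  scaled_dist p nu mu n <= 1.
Proof.
move=> p1; rewrite scaled_distE// lee_pdivrMr.
  by rewrite mul1e; exact: dist_on_le_card.
by rewrite powR_gt0// ltr0n card_box_gt0.
Qed.

Lemma scaled_dist_almost_monotone (p : R) nu mu m n : (1 <= p)%R ->
  translation_invariant nu -> translation_invariant mu -> (m <= n)%N ->
  (1 - (d * (2 * m).+1)%:R / n.+1%:R)%:E * scaled_dist p nu mu m <=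
  scaled_dist p nu mu n.
Proof.
move=> p1 inu imu mn.
have p0 : (0 < p)%R by exact: lt_le_trans p1.
set w := (2 * m).+1; set N := (2 * n).+1; pose k := (N %/ w)%N.
have k0 : (0 < k)%N by rewrite divn_gt0// ltnS leq_mul2l.
have X0 : (0 < #|{: tile_index d m n}|)%N.
  by rewrite card_tile_index expn_gt0 k0.
have D := dist_on_packing p (box d m) (box d n) _ (tile d m n) nu mu p1 X0
  (tile_disjoint d m n) (tile_subbox d m n) inu imu.
pose x : R := ((k * w)%:R / N%:R)%R.
have N0 : (0 < N%:R :> R)%R by rewrite ltr0n.
have w0 : (0 < w%:R :> R)%R by rewrite ltr0n.
have x0 : (0 < x)%R by rewrite divr_gt0// ltr0n muln_gt0 k0.
have x1 : (x <= 1)%R by rewrite ler_pdivrMr// mul1r ler_nat leq_trunc_div.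
(* The uncovered part of a side is the remainder [N %% w], below [w], and [N >= n.+1]. *)
have xw : (1 - x <= w%:R / n.+1%:R)%R.
  have -> : (1 - x = (N %% w)%:R / N%:R)%R.
    rewrite /x -[X in (X - _)%R](divff (lt0r_neq0 N0)) -mulrBl.
    by rewrite [X in (X%:R - _)%R](divn_eq N w) natrD addrC addKr.
  rewrite ler_pM ?invr_ge0//; first by rewrite ler_nat ltnW// ltn_pmod.
  by rewrite lef_pV2 ?posrE// ler_nat /N ltnS mul2n -addnn leq_addr.
have xd : (1 - (d * w)%:R / n.+1%:R <= (x ^+ d) `^ p^-1)%R.
  have x01 : (0 <= x <= 1)%R by rewrite (ltW x0).
  apply: (@le_trans _ _ (x ^+ d)%R).
    apply: le_trans (bernoulli_ineq _ _ d x01).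
    by rewrite lerD2l lerN2 natrM -mulrA ler_wpM2l.
  (* A number in []0, 1]] does not decrease under a power [p^-1 <= 1]. *)
  by apply: ger1_powR; rewrite ?exprn_gt0 ?exprn_ile1 ?(ltW x0)// invf_le1.
apply: (@le_trans _ _ (((x ^+ d) `^ p^-1)%:E * scaled_dist p nu mu m)).
  by rewrite lee_wpmul2r ?scaled_dist_ge0.
rewrite !scaled_distE// lee_pdivlMr ?powR_gt0 ?ltr0n ?card_box_gt0//.
apply: le_trans D; rewrite card_tile_index !card_box -/w -/N -/k.
rewrite (muleC (dist_on _ _ _ _)) muleA -EFinM muleAC -EFinM lee_wpmul2r//.
  by rewrite dist_on_ge0// card_box_gt0.
(* Since [x] times [N] is [k * w], the two box volumes cancel and leave the number of tiles. *)
rewrite lee_fin mulrAC !natrX -powRM ?exprn_ge0 ?(ltW x0)// -exprMn.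
rewrite /x divfK ?lt0r_neq0// natrM exprMn powRM ?exprn_ge0//.
by rewrite mulfK// lt0r_neq0// powR_gt0// exprn_gt0.
Qed.

Lemma scaled_dist_cvg (p : R) nu mu : (1 <= p)%R ->
  translation_invariant nu -> translation_invariant mu ->
  scaled_dist p nu mu n @[n --> \oo] -->
  ereal_sup (range (scaled_dist p nu mu)).
Proof.
move=> p1 inu imu.
(* Lying between 0 and 1, the scaled distances are real, as the limit lemma requires. *)
have fE n : (fine (scaled_dist p nu mu n))%:E = scaled_dist p nu mu n.
  rewrite fineK// ge0_fin_numE ?scaled_dist_ge0//.
  exact: le_lt_trans (scaled_dist_le1 _ _ _ _ p1) (ltry _).
have <- : (fun n => (fine (scaled_dist p nu mu n))%:E) = scaled_dist p nu mu.
  by apply/funext => n.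
apply: (@cvg_sup_almost_monotone _ _ (fun m => (d * (2 * m).+1)%:R)%R).
- by move=> n; rewrite -!lee_fin fE scaled_dist_ge0//= scaled_dist_le1.
- move=> m n mn.
  have := scaled_dist_almost_monotone _ _ _ _ _ p1 inu imu mn.
  by rewrite -(fE m) -(fE n) -EFinM lee_fin.
- by [].
Qed.

Lemma dist_ony_cvg nu mu :
  dist_on +oo (box d n) nu mu @[n --> \oo] -->
  ereal_sup (range (fun n => dist_on +oo (box d n) nu mu)).
Proof.
apply: ereal_nondecreasing_cvgn => m n mn; apply: dist_on_subset.
exact: box_mono.
Qed.

(** Common to both metrics: [c n] is the inverse normalization for finite [p], and 1 for
    [p = +oo]. *)
Lemma finite_metric_on_sup (p : \bar R) (c : nat -> R)
    (M : set (probability (config d S) R)) D : 1 <= p ->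
  (forall n, 0 < c n)%R ->
  (forall n nu mu, dist_on p (box d n) nu mu * (c n)%:E <= 1) ->
  (forall nu mu, M nu -> M mu ->
    D nu mu =
    ereal_sup (range (fun n => dist_on p (box d n) nu mu * (c n)%:E))) ->
  finite_metric_on M D.
Proof.
move=> p1 c0 le1 DE; pose e nu mu n := dist_on p (box d n) nu mu * (c n)%:E.
have eD nu mu n : M nu -> M mu -> e nu mu n <= D nu mu.
  by move=> Mnu Mmu; rewrite DE//; apply: ereal_sup_ubound; exists n.
have De nu mu x : M nu -> M mu -> (forall n, e nu mu n <= x) -> D nu mu <= x.
  move=> Mnu Mmu ex; rewrite DE//; apply: ge_ereal_sup => _ [n _ <-].
  exact: ex.
have e0 nu mu n : 0 <= e nu mu n.
  by rewrite mule_ge0 ?lee_fin ?(ltW (c0 n))// dist_on_ge0// card_box_gt0.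
have D0 nu mu : M nu -> M mu -> 0 <= D nu mu.
  by move=> Mnu Mmu; apply: le_trans (eD _ _ 0%N Mnu Mmu).
split=> //.
- move=> nu mu Mnu Mmu; rewrite ge0_fin_numE ?D0//.
  by apply: (@le_lt_trans _ _ 1); [apply: De => // n; exact: le1|exact: ltry].
- move=> nu mu Mnu Mmu; split=> [Dnm|E].
    apply: (dist_on_box_separates p nu mu p1) => n.
    (* A zero supremum makes every weighted box distance nonpositive, and the positive weight
       cancels. *)
    have := eD _ _ n Mnu Mmu; rewrite Dnm /e.
    by rewrite pmule_lle0// lte_fin.
  apply/eqP; rewrite eq_le D0// andbT; apply: De => // n.
  by rewrite pmule_lle0 ?lte_fin//; exact: dist_on_eq.
- move=> nu mu Mnu Mmu; rewrite !DE//.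
  have -> : (fun n => dist_on p (box d n) nu mu * (c n)%:E) =
            (fun n => dist_on p (box d n) mu nu * (c n)%:E).
    by apply/funext => n; rewrite dist_onC.
  by [].
- move=> nu mu la Mnu Mmu Mla; apply: De => // n.
  apply: (@le_trans _ _ (e nu mu n + e mu la n)); last by rewrite leeD ?eD.
  rewrite /e -ge0_muleDl ?dist_on_ge0 ?card_box_gt0//.
  by rewrite lee_wpmul2r ?dist_on_triangle// lee_fin ltW.
Qed.

End metric.

Theorem theorem5p1 (R : realType) (d : nat) (S : finPointedType)
    (hd : (1 <= d)%N) :
  (forall p : R, 1 <= p ->
    (forall nu mu : probability (config d S) R,
      translation_invariant nu -> translation_invariant mu ->
      cvgn (scaled_dist p nu mu)) /\
    finite_metric_on
      [set nu : probability (config d S) R | translation_invariant nu]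
      (Dp p)) /\
  ((forall nu mu : probability (config d S) R,
      cvgn (fun n => dist_on +oo%E (box d n) nu mu) /\
      Dinfty nu mu =
        ereal_sup (range (fun n => dist_on +oo%E (box d n) nu mu))) /\
   finite_metric_on [set: probability (config d S) R] (@Dinfty R d S)).
Proof.
have DyE nu mu : @Dinfty R d S nu mu =
    ereal_sup (range (fun n => dist_on +oo%E (box d n) nu mu)).
  exact/cvg_lim/dist_ony_cvg.
split=> [p p1|]; split.
- by move=> nu mu inu imu; apply/cvg_ex; eexists; exact: scaled_dist_cvg.
- pose c n := (#|` box d n|%:R `^ p^-1)^-1 : R.
  apply: (finite_metric_on_sup p%:E c) => //.
  + by move=> n; rewrite invr_gt0 powR_gt0// ltr0n card_box_gt0.
  + by move=> n nu mu; rewrite -scaled_distE//; exact: scaled_dist_le1.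
  + move=> nu mu inu imu; have cv := scaled_dist_cvg _ _ _ p1 inu imu.
    rewrite /Dp (cvg_lim _ cv)//.
    have -> // : scaled_dist p nu mu =
      (fun n => dist_on p%:E (box d n) nu mu * (c n)%:E)%E.
    by apply/funext => n; exact: scaled_distE.
- by move=> nu mu; split=> //; apply/cvg_ex; eexists; exact: dist_ony_cvg.
- apply: (finite_metric_on_sup +oo%E (fun=> 1)) => //.
  + exact: leey.
  + by move=> n nu mu; rewrite mule1; exact: dist_ony_le1.
  + move=> nu mu _ _; rewrite DyE.
    have -> // : (fun n => dist_on +oo (box d n) nu mu * 1)%E =
      (fun n => dist_on +oo (box d n) nu mu)%E.
    by apply/funext => n; rewrite mule1.
Qed.
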